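(* Let $A\in\mathcal{B}(\mathcal{H})$ be a positive operator with $\dim(R(A))\ge 2$ such that $R(A)$ is closed, let $q\in\mathcal{D}$ and let $T\in\mathcal{B}_{A^{1/2}}(\mathcal{H})$. Then $W_{q,A}(T)=W_q(\widetilde{T})$.
   Context: $\mathcal{H}$ is a separable infinite-dimensional complex Hilbert space with inner product $\langle\cdot,\cdot\rangle$ (linear in the first variable); $\mathcal{B}(\mathcal{H})$ is the algebra of bounded linear operators on $\mathcal{H}$; $R(A)$ is the range of $A$ and $P_{\overline{R(A)}}$ the orthogonal projection onto $\overline{R(A)}$. $A$ positive means $\langle Ax,x\rangle\ge 0$ for all $x$. Put $\langle x,y\rangle_A=\langle Ax,y\rangle$ and $\|x\|_A=\sqrt{\langle x,x\rangle_A}$. $\mathcal{D}=\{z\in\mathbb{C}:|z|\le 1\}$. $\mathcal{B}_{A^{1/2}}(\mathcal{H})=\{T\in\mathcal{B}(\mathcal{H}):\exists c>0,\ \|Tx\|_A\le c\|x\|_A\ \forall x\in\mathcal{H}\}$. The $A$-$q$-numerical range is $W_{q,A}(T)=\{\langle Tx,y\rangle_A: x,y\in\mathcal{H},\ \|x\|_A=\|y\|_A=1,\ \langle x,y\rangle_A=q\}$. $\mathbf{R}(A^{1/2})$ denotes the Hilbert space $R(A^{1/2})$ with inner product $(A^{1/2}x,A^{1/2}y)=\langle P_{\overline{R(A)}}x,P_{\overline{R(A)}}y\rangle$, $x,y\in\mathcal{H}$. Let $Z_A:\mathcal{H}\to\mathbf{R}(A^{1/2})$, $Z_Ax=Ax$.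 For $T\in\mathcal{B}_{A^{1/2}}(\mathcal{H})$, $\widetilde{T}$ denotes the unique operator in $\mathcal{B}(\mathbf{R}(A^{1/2}))$ with $Z_AT=\widetilde{T}Z_A$ (its existence and uniqueness are known). For a bounded operator $S$ on a complex Hilbert space $\mathcal{K}$ with inner product $(\cdot,\cdot)$, the $q$-numerical range is $W_q(S)=\{(Su,v):u,v\in\mathcal{K},\ \|u\|=\|v\|=1,\ (u,v)=q\}$. *)

(* Defs.v *)
From HB Require Import structures.
From mathcomp Require Import all_boot all_order all_algebra complex sesquilinear.
From mathcomp Require Import ring.
From mathcomp Require Import boolp classical_sets functions cardinality reals.
From mathcomp Require Import topology normedtype sequences.

Set Implicit Arguments.
Unset Strict Implicit.
Unset Printing Implicit Defensive.

Import Order.TTheory GRing.Theory Num.Theory Num.Def.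
Import numFieldNormedType.Exports.

Local Open Scope classical_set_scope.
Local Open Scope ring_scope.
Local Open Scope complex_scope.

HB.mixin Record NormedModule_hasInner (R : realType) H of NormedModule R[i] H
    := {
  inner : {dot H for conjC} ;
  inner_norm : forall x : H, inner x x = `|x| ^+ 2 }.

(* The inner product is linear in its first argument and conjugate-linear in the
   second.  Norms over R[i] take values in R[i], where a <= b means that b - a is
   real and nonnegative. *)
#[short(type="hilbertType")]
HB.structure Definition Hilbert (R : realType) :=
  {H of CompleteNormedModule R[i] H & NormedModule_hasInner R H}.

Definition positive_op (R : realType) (H : hilbertType R)
    (A : {linear H -> H}) : Prop :=
  continuous A /\ forall x, 0 <= inner (A x) x.

Section HilbertTheory.
Variables (R : realType) (H : hilbertType R).
Implicit Types (x y z : H).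

Lemma innerC x y : inner x y = (inner y x)^*%R.
Proof. by rewrite hermC expr0 mul1r. Qed.

Lemma innerDl x y z : inner (x + y) z = inner x z + inner y z.
Proof. by rewrite linearDl. Qed.

Lemma innerDr x y z : inner x (y + z) = inner x y + inner x z.
Proof. by rewrite linearDr. Qed.

Lemma innerBl x y z : inner (x - y) z = inner x z - inner y z.
Proof. by rewrite linearBl. Qed.

Lemma innerBr x y z : inner x (y - z) = inner x y - inner x z.
Proof. by rewrite linearBr. Qed.

Lemma innerZl (a : R[i]) x y : inner (a *: x) y = a * inner x y.
Proof. by rewrite linearZl_LR. Qed.

Lemma innerZr (a : R[i]) x y : inner x (a *: y) = a^*%R * inner x y.
Proof. by rewrite linearZr_LR. Qed.

Lemma pos_sym (A : {linear H -> H}) :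
  (forall x, 0 <= inner (A x) x) -> forall x y, inner (A x) y = inner x (A y).
Proof.
move=> A0 x y.
have Ar z : conjC (inner (A z) z) = inner (A z) z by apply/CrealP/ger0_real.
have AD u v : A (u + v) = A u + A v by rewrite linearD.
have AZ c v : A (c *: v) = c *: A v by rewrite linearZ.
rewrite [RHS]innerC.
have := Ar (x + y); rewrite AD !innerDl !innerDr !rmorphD/= !Ar.
have := Ar (x + 'i%R *: y).
rewrite AD AZ !innerDl !innerDr !innerZl !innerZr !rmorphD/= !rmorphM/=.
rewrite conjCK !Ar conjCi.
set a := inner (A x) y; set b := inner (A y) x.
rewrite -!addrA => /addrI E2 /addrI E1.
have In0 : 'i%R != 0 :> R[i] by exact: neq0Ci.
have E3 : conjC a - conjC b = b - a.
  apply: (mulfI In0); move: E2; rewrite !addrA.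
  have -> : - 'i%R * ('i%R * inner (A y) y) = 'i%R * (- 'i%R * inner (A y) y).
    by ring.
  by move/addIr => E2; rewrite mulrBr mulrBr -mulNr E2; ring.
move: E1; rewrite !addrA => /addIr E1.
have E4 : (2%:R : R[i]) * a = 2%:R * conjC b.
  have -> : 2%:R * conjC b = conjC a + conjC b - (conjC a - conjC b) by ring.
  by rewrite E1 E3; ring.
by move: E4; apply: mulfI; rewrite pnatr_eq0.
Qed.

Lemma pos_CS (A : {linear H -> H}) :
  (forall x, 0 <= inner (A x) x) ->
  forall x y, `|inner (A x) y| ^+ 2 <= inner (A x) x * inner (A y) y.
Proof.
move=> A0.
have As := pos_sym A0.
have AB u v : A (u - v) = A u - A v by rewrite linearB.
have AZ c v : A (c *: v) = c *: A v by rewrite linearZ.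
have E x y c : inner (A (x - c *: y)) (x - c *: y) =
   inner (A x) x - conjC c * inner (A x) y - c * conjC (inner (A x) y)
   + c * conjC c * inner (A y) y.
  rewrite AB AZ !innerBl !innerBr !innerZl !innerZr [inner (A x) y]As.
  by rewrite [inner x (A y)]innerC conjCK; ring.
have main x y : 0 < inner (A y) y ->
    `|inner (A x) y| ^+ 2 <= inner (A x) x * inner (A y) y.
  move=> y0; rewrite -ler_pdivrMr// -subr_ge0.
  have yr : conjC (inner (A y) y) = inner (A y) y by apply/CrealP/ger0_real.
  have := A0 (x - (inner (A x) y / inner (A y) y) *: y); rewrite E.
  rewrite normCK rmorphM fmorphV/= yr; congr (0 <= _).
  by field; exact: lt0r_neq0.
move=> x y.
have [y0|/negP y0] := boolP (0 < inner (A y) y); first exact: main.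
have [x0|/negP x0] := boolP (0 < inner (A x) x).
  by rewrite As innerC norm_conjC mulrC main.
have {}x0 : inner (A x) x = 0.
  by apply/eqP; move: (A0 x); rewrite le0r => /orP[//|/x0].
have {}y0 : inner (A y) y = 0.
  by apply/eqP; move: (A0 y); rewrite le0r => /orP[//|/y0].
have := A0 (x - inner (A x) y *: y); rewrite E x0 y0 mulr0 !addr0 sub0r.
rewrite normCK mulr0 [_^* * _]mulrC -opprD oppr_ge0 => h.
by rewrite -mulr2n pmulrn_lle0 in h.
Qed.

Definition idl : {linear H -> H} := idfun.

Lemma inner_ge0 x : 0 <= inner x x.
Proof. exact: dnorm_ge0. Qed.

Lemma inner_CS x y : `|inner x y| <= `|x| * `|y|.
Proof.
have := @pos_CS idl inner_ge0 x y.
by rewrite /= !inner_norm -exprMn ler_sqr// ?nnegrE ?mulr_ge0.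
Qed.

(* Existence of the positive square root: after rescaling so that 0 <= A <= 1,
   set B = 1 - A.  The iteration Y_0 = 0, Y_(n+1) = (B + Y_n^2) / 2 is dominated
   by the same scalar iteration started with 1 in place of B, hence converges
   pointwise to some Y with (1 - Y)^2 = 1 - B = A. *)
Fixpoint sqy (n : nat) : R :=
  if n is k.+1 then (1 + sqy k ^+ 2) / 2 else 0.

Lemma sqy_bnd n : 0 <= sqy n <= 1.
Proof.
elim: n => [|n /andP[y0 y1]] /=; first by rewrite lexx ler01.
have y2 : sqy n ^+ 2 <= 1 by rewrite exprn_ile1.
rewrite divr_ge0 ?addr_ge0 ?sqr_ge0//= ler_pdivrMr// mul1r.
by rewrite (natrD _ 1 1) lerD2l.
Qed.

Lemma sqy_incr n : sqy n <= sqy n.+1.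
Proof.
elim: n => [|n IH]; first by rewrite /= divr_ge0 ?addr_ge0 ?sqr_ge0.
rewrite [leRHS]/= {1}/sqy -/sqy ler_pM2r ?invr_gt0// lerD2l ler_sqr// nnegrE.
  by case/andP: (sqy_bnd n).
by case/andP: (sqy_bnd n.+1).
Qed.

Lemma sqy_nd : nondecreasing_seq sqy.
Proof. by apply/nondecreasing_seqP; exact: sqy_incr. Qed.

Lemma sqy_cvg : cvgn sqy.
Proof.
apply: nondecreasing_is_cvgn; first exact: sqy_nd.
by exists 1 => _ [n _ <-]; case/andP: (sqy_bnd n).
Qed.

Lemma sqy_cauchy (e : R) : 0 < e ->
  exists N, forall n, (N <= n)%N -> sqy n - sqy N < e.
Proof.
move=> e0.
have /cvgrPdist_lt/(_ e e0)[N _ hN] := sqy_cvg.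
exists N => n Nn.
have lim_ub : sqy n <= limn sqy by
  apply: nondecreasing_cvgn_le; [exact: sqy_nd | exact: sqy_cvg].
have := hN N (leqnn N) => /(le_lt_trans (ler_norm _)); apply: le_lt_trans.
by rewrite lerD2r.
Qed.

Section SqrtIter.
Variable B : {linear H -> H}.
Hypothesis Bsym : forall x y, inner (B x) y = inner x (B y).
Hypothesis B1 : forall x, `|B x| <= `|x|.

Fixpoint sqY (n : nat) : {linear H -> H} :=
  if n is k.+1 then (2%:R^-1 : R[i]) \*: (B \+ (sqY k \o sqY k)) else \0.

Lemma sqYS n x : sqY n.+1 x = 2%:R^-1 *: (B x + sqY n (sqY n x)).
Proof. by []. Qed.

Local Notation cy n := ((sqy n)%:C : R[i]).

Lemma norm_half : `|2%:R^-1 : R[i]| = 2%:R^-1.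
Proof. by rewrite ger0_norm// invr_ge0. Qed.

Lemma cyS n : cy n.+1 = 2%:R^-1 * (1 + cy n * cy n).
Proof. by rewrite /= rmorphM fmorphV rmorphD rmorphXn !rmorph1/= rmorph_nat expr2 mulrC. Qed.

Lemma cy_ge0 n : 0 <= cy n.
Proof. by rewrite ler0c; case/andP: (sqy_bnd n). Qed.

Lemma cy_le1 n : cy n <= 1.
Proof. by rewrite lecR; case/andP: (sqy_bnd n). Qed.

Lemma sqY_bnd n x : `|sqY n x| <= cy n * `|x|.
Proof.
elim: n x => [|n IH] x; first by rewrite /= normr0 mul0r.
rewrite sqYS normrZ norm_half cyS -mulrA ler_pM2l ?invr_gt0//.
rewrite (le_trans (ler_normD _ _))// mulrDl mul1r lerD ?B1//.
by rewrite (le_trans (IH _))// -mulrA ler_wpM2l ?cy_ge0.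
Qed.

Lemma linD (f : {linear H -> H}) x y : f (x + y) = f x + f y.
Proof. by rewrite linearD. Qed.

Lemma linB (f : {linear H -> H}) x y : f (x - y) = f x - f y.
Proof. by rewrite linearB. Qed.

Lemma linZ (f : {linear H -> H}) (c : R[i]) x : f (c *: x) = c *: f x.
Proof. by rewrite linearZ. Qed.

Lemma sqYB n x : sqY n (B x) = B (sqY n x).
Proof.
elim: n x => [|n IH] x; first by rewrite /= linear0.
by rewrite !sqYS !IH (linZ B) (linD B).
Qed.

Lemma sqY_sym n x y : inner (sqY n x) y = inner x (sqY n y).
Proof.
elim: n x y => [|n IH] x y; first by rewrite /= linear0l linear0r.
rewrite !sqYS innerZl innerZr innerDl innerDr Bsym !IH.
by congr (_ * _); apply/esym/CrealP/ger0_real; rewrite invr_ge0.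
Qed.

Lemma sqYD_step n x : `|sqY n.+1 x - sqY n x| <= (cy n.+1 - cy n) * `|x|.
Proof.
elim: n x => [|n IH] x.
  by have := sqY_bnd 1 x; rewrite [cy 0]rmorph0 !subr0.
pose D v := sqY n.+1 v - sqY n v.
have comm v : sqY n.+1 (sqY n v) = sqY n (sqY n.+1 v).
  by rewrite !sqYS (linZ (sqY n)) (linD (sqY n)) sqYB.
have -> : sqY n.+2 x - sqY n.+1 x = 2%:R^-1 *: (sqY n.+1 (D x) + sqY n (D x)).
  rewrite [in LHS]sqYS [X in _ - X]sqYS -scalerBr; congr (_ *: _).
  rewrite /D (linB (sqY n.+1)) (linB (sqY n)) comm opprD addrACA subrr add0r.
  by rewrite addrA subrK.
have cD0 : 0 <= cy n.+1 - cy n by rewrite subr_ge0 lecR sqy_incr.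
rewrite normrZ norm_half.
have -> : cy n.+2 - cy n.+1 = 2%:R^-1 * ((cy n.+1 + cy n) * (cy n.+1 - cy n)).
  by rewrite [in LHS]cyS [X in _ - X]cyS; ring.
rewrite -mulrA ler_pM2l ?invr_gt0// (le_trans (ler_normD _ _))// mulrDl mulrDl.
by apply: lerD; rewrite (le_trans (sqY_bnd _ _))// -mulrA ler_wpM2l ?cy_ge0 ?IH.
Qed.

Lemma sqYD m n x : (m <= n)%N -> `|sqY n x - sqY m x| <= (cy n - cy m) * `|x|.
Proof.
elim: n => [|n IH]; first by rewrite leqn0 => /eqP ->; rewrite !subrr normr0 mul0r.
rewrite leq_eqVlt => /orP[/eqP <-|]; first by rewrite !subrr normr0 mul0r.
rewrite ltnS => /IH {}IH.
have -> : sqY n.+1 x - sqY m x = (sqY n.+1 x - sqY n x) + (sqY n x - sqY m x).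
  by rewrite addrA subrK.
have -> : cy n.+1 - cy m = (cy n.+1 - cy n) + (cy n - cy m) by rewrite addrA subrK.
by rewrite mulrDl (le_trans (ler_normD _ _))// lerD// sqYD_step.
Qed.

Lemma sqY_is_cvg x : cvg (sqY n x @[n --> \oo]).
Proof.
apply: cauchy_cvg; apply: cauchy_exP => e e0.
have [er er0 ee] : exists2 er : R, 0 < er & er%:C * (1 + `|x|) = e.
  have x1 : 0 < 1 + `|x| by rewrite ltr_wpDr.
  have : 0 < e / (1 + `|x|) by rewrite divr_gt0.
  have : e / (1 + `|x|) \is Num.real by rewrite gtr0_real// divr_gt0.
  case/complex_realP => r rE; rewrite rE => r0; exists r; first by rewrite -ltcR.
  by rewrite -rE divfK// gt_eqF.
have [N hN] := sqy_cauchy er0.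
exists (sqY N x); exists N => // n /= Nn.
rewrite -ball_normE /= distrC (le_lt_trans (sqYD _ Nn))// -ee.
rewrite -rmorphB (@le_lt_trans _ _ (er%:C * `|x|))//.
  by rewrite ler_wpM2r// lecR ltW// hN.
by rewrite ltr_pM2l ?ltcR// ltrDr.
Qed.

Lemma C_le_eps (x y : R[i]) : x \is Num.real -> y \is Num.real ->
  (forall e, 0 < e -> x <= y + e) -> x <= y.
Proof.
move=> xr yr h; rewrite real_leNgt//; apply/negP => yx.
have d0 : 0 < (x - y) / 2%:R by rewrite divr_gt0// subr_gt0.
have dl : (x - y) / 2%:R < x - y.
  by rewrite ltr_pdivrMr// mulr_natr mulr2n ltrDr subr_gt0.
by have := h _ d0; rewrite -lerBlDl => /le_lt_trans/(_ dl); rewrite ltxx.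
Qed.

Definition sqL x : H := lim (sqY n x @[n --> \oo]).

Lemma sqL_cvg x : sqY n x @[n --> \oo] --> sqL x.
Proof. exact: sqY_is_cvg. Qed.

Lemma sqL_eq x a : sqY n x @[n --> \oo] --> a -> sqL x = a.
Proof. by move=> h; apply/cvg_lim. Qed.

Lemma sqL_linear : linear sqL.
Proof.
move=> c x y; apply: sqL_eq.
have -> : (fun n => sqY n (c *: x + y)) = (fun n => c *: sqY n x + sqY n y).
  by apply/funext => n; rewrite (linD (sqY n)) (linZ (sqY n)).
by apply: cvgD; [apply: cvgZr|]; exact: sqL_cvg.
Qed.

Lemma sqL_bnd x : `|sqL x| <= `|x|.
Proof.
apply: C_le_eps => [||e e0]; [exact: normr_real..|].
have /cvgrPdist_lt/(_ _ e0)[N _ /(_ N (leqnn N))/= h] := @sqL_cvg x.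
rewrite -[sqL x](subrK (sqY N x)) (le_trans (ler_normD _ _))// addrC.
apply: lerD; last exact: ltW.
by rewrite (le_trans (sqY_bnd _ _))// ler_piMl// cy_le1.
Qed.

Lemma C_eq_eps (x y : R[i]) : (forall e, 0 < e -> `|x - y| <= e) -> x = y.
Proof.
move=> h; apply/eqP; rewrite -subr_eq0 -normr_le0.
by apply: C_le_eps => [||e e0]; [exact: normr_real|exact: real0|rewrite add0r h].
Qed.

Lemma near_innerl {T : Type} (F : set_system T) {FF : Filter F} (f : T -> H) a y e :
  f @ F --> a -> 0 < e -> \forall t \near F, `|inner a y - inner (f t) y| < e.
Proof.
move=> fa e0.
have y1 : 0 < 1 + `|y| by rewrite ltr_wpDr.
have d0 : 0 < e / (1 + `|y|) by rewrite divr_gt0.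
move/cvgrPdist_lt: fa => /(_ _ d0); apply: filterS => t ht.
rewrite -innerBl (le_lt_trans (inner_CS _ _))//.
rewrite (@le_lt_trans _ _ (e / (1 + `|y|) * `|y|))//.
  by rewrite ler_wpM2r// ltW.
by rewrite -mulrA gtr_pMr// mulrC ltr_pdivrMr// mul1r ltrDr.
Qed.

Lemma near_innerr {T : Type} (F : set_system T) {FF : Filter F} (f : T -> H) a y e :
  f @ F --> a -> 0 < e -> \forall t \near F, `|inner y a - inner y (f t)| < e.
Proof.
move=> fa e0.
have y1 : 0 < 1 + `|y| by rewrite ltr_wpDr.
have d0 : 0 < e / (1 + `|y|) by rewrite divr_gt0.
move/cvgrPdist_lt: fa => /(_ _ d0); apply: filterS => t ht.
rewrite -innerBr (le_lt_trans (inner_CS _ _))// mulrC.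
rewrite (@le_lt_trans _ _ (e / (1 + `|y|) * `|y|))//.
  by rewrite ler_wpM2r// ltW.
by rewrite -mulrA gtr_pMr// mulrC ltr_pdivrMr// mul1r ltrDr.
Qed.

Lemma sqL_sym x y : inner (sqL x) y = inner x (sqL y).
Proof.
apply: C_eq_eps => e e0; have e2 : 0 < e / 2%:R by rewrite divr_gt0.
near \oo => n.
have h1 : `|inner (sqL x) y - inner (sqY n x) y| < e / 2%:R.
  by near: n; apply: near_innerl => //; exact: sqL_cvg.
have h2 : `|inner x (sqL y) - inner x (sqY n y)| < e / 2%:R.
  by near: n; apply: near_innerr => //; exact: sqL_cvg.
rewrite -[inner (sqL x) y](subrK (inner (sqY n x) y)) -addrA sqY_sym.
rewrite (le_trans (ler_normD _ _))// [e]splitr lerD ?ltW//.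
  by rewrite -sqY_sym.
by rewrite distrC.
Unshelve. all: by end_near. Qed.

Lemma sqL_fix x : sqL x = 2%:R^-1 *: (B x + sqL (sqL x)).
Proof.
suff h : sqY n (sqY n x) @[n --> \oo] --> sqL (sqL x).
  have h2 : B x + sqY n (sqY n x) @[n --> \oo] --> B x + sqL (sqL x).
    by apply: cvgD => //; exact: cvg_cst.
  have h3 := cvgZl_tmp (k := (2%:R^-1 : R[i])) h2.
  have h4 : (fun n => sqY n.+1 x) @ \oo --> 2%:R^-1 *: (B x + sqL (sqL x)).
    exact: h3.
  by move: h4; rewrite (cvg_shiftS (fun n => sqY n x)); exact: sqL_eq.
apply/cvgrPdist_lt => e e0; have e2 : 0 < e / 2%:R by rewrite divr_gt0.
have /cvgrPdist_lt/(_ _ e2) h1 := @sqL_cvg x.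
have /cvgrPdist_lt/(_ _ e2) h2 := @sqL_cvg (sqL x).
near=> n.
have -> : sqL (sqL x) - sqY n (sqY n x) =
  (sqL (sqL x) - sqY n (sqL x)) + sqY n (sqL x - sqY n x).
  by rewrite (linB (sqY n)) addrA subrK.
rewrite (le_lt_trans (ler_normD _ _))// [e]splitr ltrD//; first by near: n.
rewrite (le_lt_trans (sqY_bnd _ _))//.
rewrite (@le_lt_trans _ _ `|sqL x - sqY n x|)//; first by rewrite ler_piMl// cy_le1.
by near: n.
Unshelve. all: by end_near. Qed.

End SqrtIter.

Lemma contP (A : {linear H -> H}) : continuous A ->
  exists2 M : R[i], 0 < M & forall x, `|A x| <= M * `|x|.
Proof.
move=> /linear_bounded_continuous/linear_boundedP.
by move=> /pinfty_ex_gt0[M M0 h]; exists M.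
Qed.

Lemma boundP (A : {linear H -> H}) (M : R[i]) :
  (forall x, `|A x| <= M * `|x|) -> continuous A.
Proof.
move=> h; apply/linear_bounded_continuous/bounded_funP => r.
have [M0|M0] := boolP (0 <= M).
  by exists (M * r) => x xr; rewrite (le_trans (h x))// ler_wpM2l.
exists 0 => x _; have [->|x0] := eqVneq x 0; first by rewrite linear0 normr0.
have /(le_trans (normr_ge0 _)) := h x.
by rewrite pmulr_lge0 ?normr_gt0// (negPf M0).
Qed.

Lemma pos_op_sqrt (A : {linear H -> H}) : positive_op A ->
  exists S : {linear H -> H}, positive_op S /\ forall x, S (S x) = A x.
Proof.
move=> [/contP[M M0 AM] A0].
have Mr : conjC M^-1 = M^-1 by apply/CrealP; rewrite realV gtr0_real.
pose Bf x : H := x - M^-1 *: A x.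
have Bl : linear Bf.
  move=> c u v; rewrite /Bf (linD A) (linZ A) !scalerDr !scalerN opprD !scalerA.
  by rewrite [M^-1 * c]mulrC addrACA.
pose B : {linear H -> H} := HB.pack Bf (GRing.isLinear.Build _ _ _ _ Bf Bl).
have BE x : B x = x - M^-1 *: A x by [].
have As := pos_sym A0.
have Bs x y : inner (B x) y = inner x (B y).
  by rewrite !BE innerBl innerBr innerZl innerZr Mr As.
have B0 x : 0 <= inner (B x) x.
  rewrite BE innerBl innerZl subr_ge0 ler_pdivrMl// inner_norm.
  rewrite -(ger0_norm (A0 x)) (le_trans (inner_CS _ _))// expr2 mulrA.
  by rewrite ler_wpM2r.
have Bx x : inner (B x) x <= `|x| ^+ 2.
  rewrite BE innerBl innerZl inner_norm lerBlDr lerDl mulr_ge0// invr_ge0.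
  exact: ltW.
have B1 x : `|B x| <= `|x|.
  have [->|Bn0] := eqVneq (B x) 0; first by rewrite normr0.
  have := pos_CS B0 x (B x); rewrite [inner (B x) (B x)]inner_norm.
  rewrite ger0_norm ?exprn_ge0// => h.
  have {}h : `|B x| ^+ 2 * `|B x| ^+ 2 <= `|x| ^+ 2 * `|B x| ^+ 2.
    rewrite -[X in X <= _]expr2 (le_trans h)//.
    by rewrite ler_pM ?inner_ge0.
  by move: h; rewrite ler_pM2r ?exprn_gt0 ?normr_gt0// ler_sqr// nnegrE.
pose L : {linear H -> H} :=
  HB.pack (@sqL B) (GRing.isLinear.Build _ _ _ _ (@sqL B) (sqL_linear B1)).
pose s := sqrtC M.
have s0 : 0 <= s by rewrite sqrtC_ge0 ltW.
have Sl : linear (fun x => s *: (x - L x)).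
  move=> c u v; rewrite (linD L) (linZ L).
  by rewrite !scalerDr !scalerN !scalerDr opprD !scalerA [s * c]mulrC addrACA.
pose S : {linear H -> H} := HB.pack (fun x => s *: (x - L x))
  (GRing.isLinear.Build _ _ _ _ (fun x => s *: (x - L x)) Sl).
have SE x : S x = s *: (x - L x) by [].
have LE x : L x = sqL B x by [].
exists S; split; first split.
- apply: (@boundP _ (s * 2%:R)) => x; rewrite SE normrZ ger0_norm// -mulrA.
  rewrite ler_wpM2l// (le_trans (ler_normB _ _))// mulr2n mulrDl mul1r.
  by rewrite lerD2l LE sqL_bnd.
- move=> x; rewrite SE innerZl mulr_ge0// innerBl subr_ge0.
  have Lr : inner (L x) x \is Num.real.
    by apply/CrealP; rewrite -innerC !LE sqL_sym.
  rewrite (le_trans (real_ler_norm Lr))// inner_norm expr2.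
  by rewrite (le_trans (inner_CS _ _))// ler_wpM2r// LE sqL_bnd.
- move=> x; rewrite [in LHS](SE (S x)) SE (linZ L) (linB L) -scalerBr scalerA.
  rewrite -expr2 sqrtCK.
  have E : 2%:R *: L x = B x + L (L x).
    by rewrite [in LHS]LE [in LHS](sqL_fix B1) scalerA mulfV ?pnatr_eq0// scale1r.
  have -> : x - L x - (L x - L (L x)) = x - (2%:R *: L x - L (L x)).
    by rewrite scaler_nat mulr2n -[in RHS]addrA [in RHS]opprD [in RHS]addrA.
  rewrite E addrK BE opprB addrC subrK scalerA mulfV ?scale1r//.
  exact: lt0r_neq0.
Qed.

Lemma norm2D x y : `|x + y| ^+ 2 =
  `|x| ^+ 2 + `|y| ^+ 2 + (inner x y + conjC (inner x y)) :> R[i].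
Proof. by rewrite -!inner_norm innerDl !innerDr [inner y x]innerC; ring. Qed.

Lemma norm2N x : `|- x| ^+ 2 = `|x| ^+ 2 :> R[i].
Proof. by rewrite normrN. Qed.

Lemma parallelogram x y :
  `|x + y| ^+ 2 + `|x - y| ^+ 2 = 2%:R * (`|x| ^+ 2 + `|y| ^+ 2) :> R[i].
Proof.
rewrite !norm2D normrN.
have -> : inner x (- y) = - inner x y by rewrite -[- y]add0r innerBr linear0r sub0r.
by rewrite rmorphN/=; ring.
Qed.

Lemma sqr_invS (er : R) : 0 < er -> exists N, forall n, (N <= n)%N ->
  n.+1%:R^-1 < er.
Proof.
move=> e0; have [k] := ltr_add_invr e0; rewrite add0r => h.
exists k => n kn; apply: le_lt_trans h.
by rewrite lef_pV2 ?posrE// ler_nat ltnS.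
Qed.

Lemma C_pos_real (e : R[i]) : 0 < e -> exists2 er : R, 0 < er & er%:C = e.
Proof.
move=> e0; have : e \is Num.real by exact: gtr0_real.
by case/complex_realP => r rE; exists r; rewrite // -ltcR -rE.
Qed.

Definition lin_closed (V : set H) :=
  V 0 /\ forall (c : R[i]) u v, V u -> V v -> V (c *: u + v).

Section Projection.
Variables (V : set H) (x : H).
Hypotheses (Vl : lin_closed V) (Vc : closed V).

Let d2 (m : H) : R := complex.Re (`|x - m| ^+ 2 : R[i]).

Lemma d2E m : (d2 m)%:C = `|x - m| ^+ 2.
Proof.
have : `|x - m| ^+ 2 \is Num.real by rewrite realX ?normr_real.
by rewrite /d2 => /complex_realP[k ->].
Qed.

Lemma d2_ge0 m : 0 <= d2 m.
Proof. by rewrite -lecR d2E exprn_ge0. Qed.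

Let d := inf [set d2 m | m in V].

Lemma d_has_inf : has_inf [set d2 m | m in V].
Proof.
split; first by exists (d2 0); exists 0 => //; case: Vl.
by exists 0 => _ [m _ <-]; exact: d2_ge0.
Qed.

Lemma d_lb m : V m -> d <= d2 m.
Proof. by move=> Vm; apply: ge_inf; [case: d_has_inf|exists m]. Qed.

Lemma minseq_ex : exists m : nat -> H, forall n, V (m n) /\ d2 (m n) < d + n.+1%:R^-1.
Proof.
have h n : exists m, V m /\ d2 m < d + n.+1%:R^-1.
  have e0 : 0 < n.+1%:R^-1 :> R by rewrite invr_gt0.
  by have [_ [m Vm <-] hm] := inf_adherent e0 d_has_inf; exists m.
by have [m hm] := choice h; exists m.
Qed.

Lemma V_mid u v : V u -> V v -> V (2%:R^-1 *: (u + v)).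
Proof.
move=> Vu Vv; rewrite scalerDr; apply Vl.2 => //.
by rewrite -[_ *: v]addr0; apply Vl.2 => //; exact: Vl.1.
Qed.

Lemma realcB (a b : R) : (a - b)%:C = a%:C - b%:C.
Proof. exact: rmorphB. Qed.

Lemma realcD (a b : R) : (a + b)%:C = a%:C + b%:C.
Proof. exact: rmorphD. Qed.

Lemma realcM (a b : R) : (a * b)%:C = a%:C * b%:C.
Proof. exact: rmorphM. Qed.

Lemma realcn n : (n%:R : R)%:C = n%:R.
Proof. exact: rmorph_nat. Qed.

Lemma min_dist u v (e f : R) : V u -> V v -> d2 u < d + e -> d2 v < d + f ->
  `|u - v| ^+ 2 <= (2%:R * (e + f))%:C.
Proof.
move=> Vu Vv ue vf.
have := parallelogram (x - u) (x - v).
have -> : x - u + (x - v) = 2%:R *: (x - 2%:R^-1 *: (u + v)).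
  rewrite scalerBr scalerA mulfV ?pnatr_eq0// scale1r scaler_nat mulr2n.
  by rewrite addrACA opprD.
have -> : x - u - (x - v) = - (u - v).
  by rewrite !opprB addrC addrA subrK.
rewrite norm2N normrZ exprMn -!d2E ger0_norm// => E.
have -> : `|u - v| ^+ 2 =
  (2%:R * (d2 u + d2 v) - 2%:R * 2%:R * d2 (2%:R^-1 *: (u + v)))%:C.
  move: E; rewrite [2%:R ^+ 2]expr2 => E.
  rewrite realcB !realcM realcD !realcn -E.
  by rewrite addrAC subrr add0r.
rewrite lecR; have := d_lb (V_mid Vu Vv).
set w := d2 (_ *: _) => dw.
rewrite lerBlDr; apply: (@le_trans _ _ (2%:R * ((d + e) + (d + f)))).
  by rewrite ler_pM2l// lerD// ltW.
have -> : 2%:R * (d + e + (d + f)) = 2%:R * (e + f) + 2%:R * 2%:R * d by ring.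
by rewrite lerD2l ler_pM2l// mulr_gt0.
Qed.

Lemma proj_exists : exists p, V p /\ forall m, V m -> inner (x - p) m = 0.
Proof.
have [m hm] := minseq_ex.
have mcvg : cvg (m @ \oo).
  apply: cauchy_cvg; apply: cauchy_exP => e e0.
  have [er er0 ee] := C_pos_real e0.
  have er2 : 0 < er ^+ 2 / 4%:R by rewrite divr_gt0// exprn_gt0.
  have [N hN] := sqr_invS er2.
  exists (m N); exists N => // n /= Nn; rewrite -ball_normE /=.
  have [VN mN] := hm N; have [Vn mn] := hm n.
  rewrite -ltr_sqr ?nnegrE// ?(ltW e0)//.
  apply: (le_lt_trans (min_dist VN Vn mN mn)).
  rewrite -ee -rmorphXn ltcR.
  have -> : er ^+ 2 = 2%:R * (er ^+ 2 / 4%:R + er ^+ 2 / 4%:R) by field.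
  by rewrite ltr_pM2l// ltrD// hN.
have [p mp] := (cvg_ex _).1 mcvg.
have Vp : V p.
  apply: (closed_cvg V Vc _ _ mp).
  by apply: nearW => n; case: (hm n).
exists p; split => // w Vw; apply: C_eq_eps => e e0; rewrite subr0.
have [->|w0] := eqVneq w 0; first by rewrite linear0r normr0 ltW.
have nw : 0 < `|w| ^+ 2 :> R[i] by rewrite exprn_gt0// normr_gt0.
have [wr wr0 wE] := C_pos_real nw.
have key n : `|inner (x - m n) w| ^+ 2 <= `|w| ^+ 2 * (n.+1%:R^-1 : R)%:C.
  have [Vn mn] := hm n.
  set a := inner (x - m n) w.
  have Vt : V ((a / `|w| ^+ 2) *: w + m n) by apply Vl.2.
  have := d_lb Vt; rewrite -ltrBlDr in mn => /(lt_le_trans mn).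
  rewrite -ltcR rmorphB/= !d2E.
  have -> : x - (a / `|w| ^+ 2 *: w + m n) = (x - m n) + - (a / `|w| ^+ 2 *: w).
    by rewrite opprD addrCA addrC.
  rewrite (norm2D (x - m n) (- _)) norm2N normrZ.
  have -> : inner (x - m n) (- (a / `|w| ^+ 2 *: w)) = - (`|a| ^+ 2 / `|w| ^+ 2).
    rewrite -scaleNr innerZr -/a rmorphN rmorphM/= normCK.
    have -> : conjC (`|w| ^+ 2)^-1 = (`|w| ^+ 2)^-1.
      by apply/CrealP; rewrite realV gtr0_real.
    by ring.
  have ar : conjC (- (`|a| ^+ 2 / `|w| ^+ 2)) = - (`|a| ^+ 2 / `|w| ^+ 2).
    by apply/CrealP; rewrite realN ger0_real// divr_ge0 ?exprn_ge0.
  rewrite ar normrM normfV normrX normr_id exprMn.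
  rewrite -addrA ltrD2l => h.
  rewrite -ler_pdivrMl// mulrC.
  have : - (n.+1%:R^-1 : R)%:C < - (`|a| ^+ 2 / `|w| ^+ 2).
    move: h; congr (_ < _); field.
    by rewrite -normr_eq0 in w0.
  by rewrite ltrN2 => /ltW.
have e2 : 0 < e / 2%:R by rewrite divr_gt0.
have [er er0 ee] := C_pos_real e2.
have er2 : 0 < er ^+ 2 / wr by rewrite divr_gt0// exprn_gt0.
have [N hN] := sqr_invS er2.
near \oo => n.
have Nn : (N <= n)%N by near: n; exists N.
have h1 : `|inner p w - inner (m n) w| < e / 2%:R by near: n; exact: near_innerl.
have h2 : `|inner (x - m n) w| <= e / 2%:R.
  rewrite -ler_sqr ?nnegrE ?(ltW e2)// (le_trans (key n))//.
  rewrite -ee -rmorphXn -wE -rmorphM lecR mulrC -ler_pdivlMr//.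
  by rewrite ltW// hN.
have -> : inner (x - p) w = inner (x - m n) w - (inner p w - inner (m n) w).
  by rewrite !innerBl opprB addrA subrK.
by rewrite (le_trans (ler_normB _ _))// [e]splitr lerD// ltW.
Unshelve. all: by end_near. Qed.

End Projection.

Lemma closure_normP (V : set H) x :
  closure V x <-> forall e : R[i], 0 < e -> exists2 v, V v & `|x - v| < e.
Proof.
split=> [cx e e0|h B].
  have [v [Vv]] := cx _ (nbhsx_ballx x e e0).
  by rewrite -ball_normE /= => xv; exists v.
move=> /nbhs_ballP[e /= e0 eB]; have [v Vv xv] := h e e0.
by exists v; split => //; apply: eB; rewrite -ball_normE.
Qed.

Lemma closure_lin (V : set H) : lin_closed V -> lin_closed (closure V).
Proof.
move=> [V0 Vl]; split; first exact: subset_closure.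
move=> c u v /closure_normP hu /closure_normP hv; apply/closure_normP => e e0.
have e2 : 0 < e / 2%:R by rewrite divr_gt0.
have c1 : 0 < 1 + `|c| by rewrite ltr_wpDr.
have e3 : 0 < e / 2%:R / (1 + `|c|) by rewrite divr_gt0.
have [u' Vu' uu'] := hu _ e3; have [v' Vv' vv'] := hv _ e2.
exists (c *: u' + v'); first exact: Vl.
have -> : c *: u + v - (c *: u' + v') = c *: (u - u') + (v - v').
  by rewrite opprD addrACA scalerBr.
rewrite (le_lt_trans (ler_normD _ _))// [e]splitr ler_ltD// normrZ.
rewrite (@le_trans _ _ (`|c| * (e / 2%:R / (1 + `|c|))))//.
  by rewrite ler_wpM2l// ltW.
by rewrite mulrCA ger_pMr// ler_pdivrMr// mul1r lerDr.
Qed.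

Lemma range_lin (A : {linear H -> H}) : lin_closed (range A).
Proof.
split; first by exists 0 => //; rewrite linear0.
by move=> c _ _ [x _ <-] [y _ <-]; exists (c *: x + y) => //; rewrite (linD A) (linZ A).
Qed.

(* Orthogonal projection onto a closed subspace V (see orthprojP). *)
Definition orthproj (V : set H) (x : H) : H :=
  xget 0 [set p | V p /\ forall m, V m -> inner (x - p) m = 0].

Lemma orthprojP (V : set H) x : lin_closed V -> closed V ->
  V (orthproj V x) /\ forall m, V m -> inner (x - orthproj V x) m = 0.
Proof.
move=> Vl Vc; rewrite /orthproj; case: xgetP => [_ -> []//|h].
by have [p hp] := @proj_exists V x Vl Vc; case: (h p).
Qed.

Lemma orthproj_uniq (V : set H) x p : lin_closed V -> closed V ->
  V p -> (forall m, V m -> inner (x - p) m = 0) -> orthproj V x = p.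
Proof.
move=> Vl Vc Vp hp; have [Vq hq] := orthprojP x Vl Vc.
set q := orthproj V x in Vq hq *.
have Vqp : V (q - p).
  by rewrite addrC -[- p]scaleN1r; apply Vl.2.
apply/eqP; rewrite -subr_eq0 -normr_eq0 -sqrf_eq0 -inner_norm.
have -> : inner (q - p) (q - p) = inner (x - p) (q - p) - inner (x - q) (q - p).
  by rewrite -innerBl opprB [x - p + _]addrC addrA subrK.
by rewrite hp// hq// subrr.
Qed.

Lemma orthproj_linear (V : set H) : lin_closed V -> closed V ->
  linear (orthproj V).
Proof.
move=> Vl Vc c x y; have [Vx hx] := orthprojP x Vl Vc.
have [Vy hy] := orthprojP y Vl Vc.
apply: orthproj_uniq => //; first exact: Vl.2.
move=> m Vm; have -> : c *: x + y - (c *: orthproj V x + orthproj V y) =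
  c *: (x - orthproj V x) + (y - orthproj V y).
  by rewrite opprD addrACA scalerBr.
by rewrite innerDl innerZl hx// hy// mulr0 addr0.
Qed.

Lemma orthproj_id (V : set H) x : lin_closed V -> closed V -> V x ->
  orthproj V x = x.
Proof.
by move=> Vl Vc Vx; apply: orthproj_uniq => // m _; rewrite subrr linear0l.
Qed.

End HilbertTheory.

(* A^(1/2): the positive bounded square root of A, which is unique. *)
Definition sqrt_op (R : realType) (H : hilbertType R) (A : {linear H -> H})
  (hA : positive_op A) : {linear H -> H} := projT1 (cid (pos_op_sqrt hA)).

Lemma sqrt_opP (R : realType) (H : hilbertType R) (A : {linear H -> H})
  (hA : positive_op A) :
  positive_op (sqrt_op hA) /\ forall x, sqrt_op hA (sqrt_op hA x) = A x.
Proof. exact: projT2 (cid (pos_op_sqrt hA)). Qed.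

Section RangeSqrt.
Variables (R : realType) (H : hilbertType R) (A : {linear H -> H}).
Hypothesis hA : positive_op A.

Local Notation S := (sqrt_op hA).
Local Notation P := (orthproj (closure (range A))).

(* The vector space R(A^(1/2)).  Its Hilbert space structure below is not the
   one induced by H: its inner product is (A^(1/2) x, A^(1/2) y) = <P x, P y>,
   with P the orthogonal projection onto the closure of R(A), see
   range_innerE. *)
Record range_sqrt : Type := RangeSqrt {
  range_val :> H ;
  range_valP : range_val \in (range S : set H) }.

HB.instance Definition _ := [isSub of range_sqrt for range_val].
HB.instance Definition _ := [Choice of range_sqrt by <:].

Lemma range_sqrt_submod :
  submod_closed [pred u : H | u \in (range S : set H)].
Proof.
split; first by rewrite inE; exists 0 => //; rewrite linear0.
move=> c u v; rewrite !inE => -[x _ <-] [y _ <-].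
by exists (c *: x + y) => //; rewrite (linD S) (linZ S).
Qed.

HB.instance Definition _ :=
  GRing.SubChoice_isSubLmodule.Build R[i] H
    [pred u : H | u \in (range S : set H)] range_sqrt range_sqrt_submod.

Lemma range_sqrt_ex (u : range_sqrt) : exists x, S x = range_val u.
Proof. by case: u => u /= /set_mem[x _ <-]; exists x. Qed.

Definition range_pre (u : range_sqrt) : H := projT1 (cid (range_sqrt_ex u)).

Lemma range_preK u : S (range_pre u) = range_val u.
Proof. exact: projT2 (cid (range_sqrt_ex u)). Qed.

Definition range_mk (x : H) : range_sqrt :=
  @RangeSqrt (S x) (mem_set (ex_intro2 _ _ x I erefl)).

Let Vl : lin_closed (closure (range A)).
Proof. exact/closure_lin/range_lin. Qed.

Let Vc : closed (closure (range A)).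
Proof. exact: closed_closure. Qed.

Lemma proj_ker x : S x = 0 -> P x = 0.
Proof.
move=> Sx; apply: orthproj_uniq => //; first exact: Vl.1.
have Ax : A x = 0 by rewrite -(sqrt_opP hA).2 Sx linear0.
move=> m /closure_normP hm; rewrite subr0; apply: C_eq_eps => e e0.
have x1 : 0 < 1 + `|x| by rewrite ltr_wpDr.
have d0 : 0 < e / (1 + `|x|) by rewrite divr_gt0.
have [_ [y _ <-] my] := hm _ d0.
rewrite subr0 -[m](subrK (A y)) innerDr -(pos_sym hA.2) Ax linear0l addr0.
rewrite (le_trans (inner_CS _ _))//.
rewrite (@le_trans _ _ (`|x| * (e / (1 + `|x|))))//.
  by rewrite ler_wpM2l// ltW.
by rewrite mulrCA ger_pMr// ler_pdivrMr// mul1r lerDr.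
Qed.

Lemma P_lin : linear P.
Proof. exact: orthproj_linear. Qed.

Lemma P_sub x y : P (x - y) = P x - P y.
Proof. by have := P_lin (-1) y x; rewrite !scaleN1r => h; rewrite addrC h addrC. Qed.

Lemma proj_range_pre x : P (range_pre (range_mk x)) = P x.
Proof.
apply/eqP; rewrite -subr_eq0 -P_sub; apply/eqP/proj_ker.
by rewrite (linB S) range_preK subrr.
Qed.

Definition range_lift (u : range_sqrt) : H := P (range_pre u).

Lemma range_mkK u : range_mk (range_pre u) = u.
Proof. by apply/val_inj; rewrite /= range_preK. Qed.

Lemma range_lift_mk x : range_lift (range_mk x) = P x.
Proof. exact: proj_range_pre. Qed.

Lemma range_mk_lin : linear range_mk.
Proof. by move=> c x y; apply/val_inj; rewrite /= (linD S) (linZ S). Qed.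

Lemma range_lift_lin : linear range_lift.
Proof.
move=> c u v; rewrite -{1}[u]range_mkK -{1}[v]range_mkK -range_mk_lin.
by rewrite range_lift_mk P_lin.
Qed.

Lemma range_lift_mem u : closure (range A) (range_lift u).
Proof. by case: (@orthprojP _ _ _ (range_pre u) Vl Vc). Qed.

Lemma S_perp x : (forall m, closure (range A) m -> inner x m = 0) -> S x = 0.
Proof.
move=> h; apply/eqP; rewrite -normr_eq0 -sqrf_eq0 -inner_norm.
rewrite (pos_sym (sqrt_opP hA).1.2) (sqrt_opP hA).2 h//.
by apply: subset_closure; exists x.
Qed.

Lemma SP x : S (P x) = S x.
Proof.
apply/eqP; rewrite eq_sym -subr_eq0 -(linB S); apply/eqP/S_perp.
by case: (@orthprojP _ _ _ x Vl Vc).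
Qed.

Lemma S_range_lift u : S (range_lift u) = range_val u.
Proof. by rewrite SP range_preK. Qed.

Lemma range_lift_inj u : range_lift u = 0 -> u = 0.
Proof. by move=> h; apply/val_inj; rewrite /= -S_range_lift h linear0. Qed.

Definition range_inner (u v : range_sqrt) : R[i] :=
  inner (P (range_pre u)) (P (range_pre v)).

Lemma range_innerE x y :
  range_inner (range_mk x) (range_mk y) = inner (P x) (P y).
Proof. by rewrite /range_inner !proj_range_pre. Qed.

Definition range_norm (u : range_sqrt) : R[i] := sqrtC (range_inner u u).

Lemma range_normE u : range_norm u = `|range_lift u|.
Proof. by rewrite /range_norm /range_inner inner_norm sqrCK. Qed.

Lemma range_normD u v : range_norm (u + v) <= range_norm u + range_norm v.
Proof.
have := range_lift_lin 1 u v; rewrite !scale1r !range_normE => ->.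
exact: ler_normD.
Qed.

Lemma range_normZ (c : R[i]) u : range_norm (c *: u) = `|c| * range_norm u.
Proof.
have := range_lift_lin c u 0; rewrite !range_normE addr0 => ->.
have -> : range_lift 0 = 0.
  have := range_lift_lin (-1) 0 0.
  by rewrite scaleN1r oppr0 addr0 scaleN1r addNr.
by rewrite addr0 normrZ.
Qed.

Lemma range_norm0 u : range_norm u = 0 -> u = 0.
Proof. by rewrite range_normE => /normr0_eq0/range_lift_inj. Qed.

HB.instance Definition _ := @Lmodule_isNormed.Build R[i] range_sqrt range_norm
  range_normD range_normZ range_norm0.

Lemma range_normrE u : `|u| = `|range_lift u| :> R[i].
Proof. exact: range_normE. Qed.

Lemma range_liftB u v : range_lift (u - v) = range_lift u - range_lift v.
Proof.
by have := range_lift_lin (-1) v u; rewrite !scaleN1r => h; rewrite addrC h addrC.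
Qed.

Lemma range_sqrt_complete (F : set_system range_sqrt) :
  ProperFilter F -> cauchy F -> cvg F.
Proof.
move=> FF /cauchyP Fc.
have liftc : cvg (range_lift @ F).
  apply: cauchy_cvg; apply: cauchy_exP => e e0.
  have [u Fu] := Fc e e0; exists (range_lift u).
  apply: (@filterS _ F _ (ball u e) (range_lift @^-1` ball (range_lift u) e)) => //.
  move=> v uv /=; have {}uv : `|u - v| < e by move: uv; rewrite -ball_normE.
  by rewrite range_normrE range_liftB in uv; rewrite -ball_normE.
have [z hz] := (cvg_ex _).1 liftc.
have Vz : closure (range A) z.
  apply: (closed_cvg _ Vc _ _ hz).
  by apply: nearW => u; exact: range_lift_mem.
apply/cvg_ex; exists (range_mk z); apply/(@cvgrPdist_lt _ _ _ F _ id) => e e0.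
move/cvgrPdist_lt: hz => /(_ _ e0); apply: filterS => u.
by rewrite range_normrE range_liftB range_lift_mk orthproj_id.
Qed.

HB.instance Definition _ := Uniform_isComplete.Build range_sqrt
  range_sqrt_complete.

Lemma range_inner_bilinear :
  bilinear_for ( *%R : GRing.Scale.law _ _)
    (conjC \; *%R : GRing.Scale.law _ _) range_inner.
Proof.
split=> [v|u] c x y /=; rewrite /range_inner.
- by have := range_lift_lin c x y; rewrite /range_lift => ->; rewrite innerDl innerZl.
- by have := range_lift_lin c x y; rewrite /range_lift => ->; rewrite innerDr innerZr.
Qed.

HB.instance Definition _ := bilinear_isBilinear.Build R[i] range_sqrt range_sqrt
  R[i] _ _ range_inner range_inner_bilinear.

Lemma range_inner_herm u v :
  range_inner u v = (-1) ^+ false * conjC (range_inner v u).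
Proof. by rewrite expr0 mul1r /range_inner innerC. Qed.

HB.instance Definition _ :=
  isHermitianSesquilinear.Build R[i] range_sqrt false conjC range_inner
    range_inner_herm.

Lemma range_inner_norm u : range_inner u u = `|u| ^+ 2.
Proof. by rewrite range_normrE /range_inner inner_norm. Qed.

Lemma range_inner_gt0 u : u != 0 -> 0 < range_inner u u.
Proof. by move=> u0; rewrite range_inner_norm exprn_gt0// normr_gt0. Qed.

HB.instance Definition _ :=
  isDotProduct.Build R[i] range_sqrt range_inner range_inner_gt0.

HB.instance Definition _ :=
  NormedModule_hasInner.Build R range_sqrt (inner := range_inner) range_inner_norm.

End RangeSqrt.

(* The map Z_A : H -> R(A^(1/2)), x |-> A x. *)
Lemma ZA_subproof (R : realType) (H : hilbertType R) (A : {linear H -> H})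
  (hA : positive_op A) (x : H) : A x \in (range (sqrt_op hA) : set H).
Proof. by rewrite inE -(sqrt_opP hA).2; exists (sqrt_op hA x). Qed.

Definition ZA (R : realType) (H : hilbertType R) (A : {linear H -> H})
  (hA : positive_op A) (x : H) : range_sqrt hA := RangeSqrt (ZA_subproof hA x).

Definition separable (T : topologicalType) : Prop :=
  exists D : set T, countable D /\ dense D.

(* V contains n linearly independent vectors; for a linear subspace V, this is
   dim V >= n. *)
Definition dim_ge (R : realType) (H : hilbertType R) (V : set H) (n : nat)
    : Prop :=
  exists e : 'I_n -> H, (forall i, V (e i)) /\
    forall a : 'I_n -> R[i], \sum_(i < n) a i *: e i = 0 -> forall i, a i = 0.

Definition infinite_dim (R : realType) (H : hilbertType R) : Prop :=
  forall n, dim_ge [set: H] n.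

Section NumericalRanges.
Variables (R : realType).

Definition innerA (H : hilbertType R) (A : {linear H -> H}) (x y : H) : R[i] :=
  inner (A x) y.

Definition normA (H : hilbertType R) (A : {linear H -> H}) (x : H) : R[i] :=
  sqrtC (innerA A x x).

(* Membership in B_(A^(1/2))(H). *)
Definition bounded_opA (H : hilbertType R) (A T : {linear H -> H}) : Prop :=
  continuous T /\
  exists2 c : R, 0 < c & forall x, normA A (T x) <= c%:C * normA A x.

Definition numrange_qA (H : hilbertType R) (A : {linear H -> H}) (q : R[i])
    (T : {linear H -> H}) : set R[i] :=
  [set z | exists x y, [/\ normA A x = 1, normA A y = 1, innerA A x y = q
                         & z = innerA A (T x) y]].

Definition numrange_q (K : hilbertType R) (q : R[i]) (S : {linear K -> K})
    : set R[i] :=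
  [set z | exists u v : K, [/\ `|u| = 1, `|v| = 1, inner u v = q
                             & z = inner (S u) v]].

End NumericalRanges.

(* Main.v *)
Require Import Defs.
From mathcomp Require Import all_boot all_order all_algebra complex sesquilinear.
From mathcomp Require Import boolp classical_sets functions cardinality reals.
From mathcomp Require Import topology normedtype sequences.

Set Implicit Arguments.
Unset Strict Implicit.
Unset Printing Implicit Defensive.

Import Order.TTheory GRing.Theory Num.Theory Num.Def.
Import numFieldNormedType.Exports.

Local Open Scope classical_set_scope.
Local Open Scope ring_scope.
Local Open Scope complex_scope.

(** The map [ZA hA] intertwines [T] and [Tt] by hypothesis, so the two numerical
ranges agree as soon as [ZA hA] carries the semi-inner product <Ax, y> to the
inner product of R(A^(1/2)) and is onto.

Write S = A^(1/2) and P for the orthogonal projection onto the closure of R(A).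

The first point ([inner_ZA]) holds for every positive A.  As A x = S (S x), the
inner product of A x and A y in R(A^(1/2)) is <P S x, P S y>; but P fixes the
range of S ([proj_sqrt_op]), because R(S) is orthogonal to ker S, which contains
the orthogonal complement of R(A).  What remains is <S x, S y> = <A x, y>.

The second point ([ZA_surj]) is where the closedness of R(A) enters, in the form
R(S) = R(A): one has S x = S (P x), and P x now belongs to R(A), say P x = A y,
whence S x = S (A y) = A (S y). *)

Section ZAIsometry.
Variables (R : realType) (H : hilbertType R) (A : {linear H -> H}).
Hypothesis hA : positive_op A.

Local Notation S := (sqrt_op hA).
Local Notation P := (orthproj (closure (range A))).

(** The defect S x - P (S x) is orthogonal to R(A), hence killed by S; being
killed by the symmetric S, it is orthogonal to S x as well, so to itself. *)
Lemma proj_sqrt_op x : P (S x) = S x.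
Proof.
have [PSx perp] := orthprojP (S x) (closure_lin (range_lin A))
  (@closed_closure _ (range A)).
apply/esym/eqP; rewrite -subr_eq0 -normr_eq0 -sqrf_eq0 -inner_norm.
rewrite innerBr (perp _ PSx) -(pos_sym (sqrt_opP hA).1.2) S_perp//.
by rewrite linear0l subrr.
Qed.

Lemma ZA_range_mk x : ZA hA x = range_mk hA (S x).
Proof. by apply/val_inj; rewrite /= (sqrt_opP hA).2. Qed.

Lemma inner_ZA x y : inner (ZA hA x) (ZA hA y) = innerA A x y.
Proof.
rewrite !ZA_range_mk [LHS]range_innerE !proj_sqrt_op.
by rewrite -(pos_sym (sqrt_opP hA).1.2) (sqrt_opP hA).2.
Qed.

Lemma norm_ZA x : `|ZA hA x| = normA A x.
Proof. by rewrite /normA -inner_ZA inner_norm sqrCK. Qed.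

Lemma ZA_surj (A_closed : closed (range A)) (u : range_sqrt hA) :
  exists x, ZA hA x = u.
Proof.
have [y _ Ay] : range A (range_lift u).
  by rewrite ((closure_id (range A)).1 A_closed); exact: range_lift_mem.
exists (S y); apply/val_inj => /=.
by rewrite -(S_range_lift u) -Ay -!(sqrt_opP hA).2.
Qed.

End ZAIsometry.

Theorem corollary2p5 (R : realType) (H : hilbertType R)
  (H_sep : separable H) (H_infdim : infinite_dim H)
  (A : {linear H -> H}) (hA : positive_op A)
  (A_dim : dim_ge (range A) 2) (A_closed : closed (range A))
  (q : R[i]) (hq : `|q| <= 1)
  (T : {linear H -> H}) (hT : bounded_opA A T)
  (Tt : {linear range_sqrt hA -> range_sqrt hA}) (Tt_cont : continuous Tt)
  (ZT : forall x : H, ZA hA (T x) = Tt (ZA hA x)) :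
  numrange_qA A q T = numrange_q q Tt.
Proof.
rewrite eqEsubset; split=> z.
  move=> [x [y [nx ny xy ->]]]; exists (ZA hA x), (ZA hA y).
  by rewrite !norm_ZA -ZT !inner_ZA.
move=> [u [v]]; have [x <-] := ZA_surj A_closed u.
have [y <-] := ZA_surj A_closed v.
by rewrite !norm_ZA -ZT !inner_ZA => -[nx ny xy ->]; exists x, y.
Qed.
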